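(* Given a point $(\hat x,\hat y,\hat u)\in\mathbb{R}_+^{3T-1}$, there exists an $\mathcal{O}(T^3)$ time separation algorithm that finds the most violated inequality at $(\hat x,\hat y,\hat u)$, if any is violated, among the family of inequalities \begin{align*} x_{t-2}-x_{t-1}+x_t\le{}&\overline{V}y_{t-2}-(\overline{V}-V)y_{t-1}+\overline{V}y_t+V\sum_{i\in S_0}\Bigl(y_i-\sum_{j=0}^{\min\{L-1,i-2\}}u_{i-j}\Bigr)+\phi(u,t)\\ &+V\sum_{i\in S\cup\{\hat t\}}(d_i-i)\Bigl(y_i-\sum_{j=0}^{L-1}u_{i-j}\Bigr)+\alpha(t)\Bigl(y_{t+m+1}-\sum_{j=0}^{L-1}u_{t+m+1-j}\Bigr) \end{align*} indexed by all $(t,m,S)$ with $t\in[3,T-1]_{\mathbb{Z}}$, $m$ an integer with $[\hat t-t-1]^+\le m\le\min\{T-t-1,(\overline{C}-\overline{V})/V\}$, and $S\subseteq[\hat t+1,t+m]_{\mathbb{Z}}$. Here $\hat t=\max\{t+1,L+1\}$, $S_0=[t+1,\hat t-1]_{\mathbb{Z}}$, $\phi(u,t)=V\sum_{k=3}^{\min\{t-2,L-1\}}(k-2)u_{t-k}$, $d_i=\min\{a\in S\cup\{t+m+1\}:a>i\}$ for $i\in S\cup\{\hat t\}$, and $\alpha(t)=\overline{C}-\overline{V}-mV$.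
   Context: $T$ (number of time periods) and $L$ (minimum-up time) are positive integers with $T\ge L+1$, and $\overline{C},\overline{V},V$ are real parameters (generation upper bound, start-up/shut-down ramp rate, ramp rate) with $\overline{V}\le\overline{C}$ and $V>0$. Vectors are $x=(x_1,\dots,x_T)$, $y=(y_1,\dots,y_T)$, $u=(u_2,\dots,u_T)$, so $(x,y,u)\in\mathbb{R}^{3T-1}$. For integers $a,b$, $[a,b]_{\mathbb{Z}}$ is the set of integers $i$ with $a\le i\le b$; $[a]^+=\max\{a,0\}$; empty sums are $0$. The violation of an inequality at a point is its left-hand side minus its right-hand side evaluated at the point; an inequality is violated if this is positive, and most violated means maximum violation over the family. In the running time bound, the number $(\overline{C}-\overline{V})/V$ (bounding $m$) is regarded as a constant, and the asymptotics are in $T$.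
   Formalization: When m = [t̂−t−1]^+ one has t̂ = t+m+1 and the set defining d_{t̂} is empty, so d_{t̂} is undefined as written; it is taken to be t+m+1 = t̂, so that the term (d_{t̂}−t̂)(…) is 0. *)

(* Defs.v *)
From HB Require Import structures.
From mathcomp Require Import all_boot all_order all_algebra.
From mathcomp Require Import reals.

Set Implicit Arguments.
Unset Strict Implicit.
Unset Printing Implicit Defensive.

Import Order.TTheory GRing.Theory Num.Theory.

Local Open Scope ring_scope.

(* Real RAM.  A program works on finitely many arrays of natural numbers and  *)
(* finitely many arrays of reals; an array is named by a natural number that  *)
(* is fixed in the program text, and its cells are addressed by computed      *)
(* indices.  Every cell access, every literal, every arithmetic operation or  *)
(* comparison and every control decision costs one unit.  Index arithmetic    *)
(* has neither multiplication nor division, reals are never rounded to        *)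
(* integers, and the only literals are natural numbers.                       *)

Inductive iexp : Type :=
  | ILit of nat
  | IGet of nat & iexp
  | IAdd of iexp & iexp
  | ISub of iexp & iexp.

Inductive rexp : Type :=
  | RNat of iexp
  | RGet of nat & iexp
  | RAdd of rexp & rexp
  | RSub of rexp & rexp
  | RMul of rexp & rexp
  | RDiv of rexp & rexp.

Inductive bexp : Type :=
  | BIle of iexp & iexp
  | BRle of rexp & rexp
  | BNot of bexp
  | BAnd of bexp & bexp.

(* [ISet a i e] is the assignment a[i] := e, and likewise for [RSet].         *)
Inductive com : Type :=
  | Skip
  | ISet of nat & iexp & iexp
  | RSet of nat & iexp & rexp
  | Seq of com & com
  | If of bexp & com & com
  | While of bexp & com.

Fixpoint icost (e : iexp) : nat :=
  match e with
  | ILit _ => 1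
  | IGet _ e1 => (icost e1).+1
  | IAdd e1 e2 | ISub e1 e2 => (icost e1 + icost e2).+1
  end.

Fixpoint rcost (e : rexp) : nat :=
  match e with
  | RNat e1 | RGet _ e1 => (icost e1).+1
  | RAdd e1 e2 | RSub e1 e2 | RMul e1 e2 | RDiv e1 e2 =>
      (rcost e1 + rcost e2).+1
  end.

Fixpoint bcost (b : bexp) : nat :=
  match b with
  | BIle e1 e2 => (icost e1 + icost e2).+1
  | BRle e1 e2 => (rcost e1 + rcost e2).+1
  | BNot b1 => (bcost b1).+1
  | BAnd b1 b2 => (bcost b1 + bcost b2).+1
  end.

Section Semantics.

Variable R : realType.

Record state : Type := State {
  imem : nat -> nat -> nat;
  rmem : nat -> nat -> R
}.

Definition upd (A : Type) (f : nat -> nat -> A) (a i : nat) (v : A) :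
    nat -> nat -> A :=
  fun b j => if (b == a) && (j == i) then v else f b j.

Fixpoint ieval (s : state) (e : iexp) : nat :=
  match e with
  | ILit n => n
  | IGet a e1 => imem s a (ieval s e1)
  | IAdd e1 e2 => (ieval s e1 + ieval s e2)%N
  | ISub e1 e2 => (ieval s e1 - ieval s e2)%N
  end.

Fixpoint reval (s : state) (e : rexp) : R :=
  match e with
  | RNat e1 => (ieval s e1)%:R
  | RGet a e1 => rmem s a (ieval s e1)
  | RAdd e1 e2 => reval s e1 + reval s e2
  | RSub e1 e2 => reval s e1 - reval s e2
  | RMul e1 e2 => reval s e1 * reval s e2
  | RDiv e1 e2 => reval s e1 / reval s e2
  end.

Fixpoint beval (s : state) (b : bexp) : bool :=
  match b with
  | BIle e1 e2 => (ieval s e1 <= ieval s e2)%N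
  | BRle e1 e2 => reval s e1 <= reval s e2
  | BNot b1 => ~~ beval s b1
  | BAnd b1 b2 => beval s b1 && beval s b2
  end.

(* [exec c s s' k]: started in s, the program c halts in s' after k steps.    *)
Inductive exec : com -> state -> state -> nat -> Prop :=
  | ExecSkip s : exec Skip s s 1
  | ExecISet s a i e :
      exec (ISet a i e) s
        (State (upd (imem s) a (ieval s i) (ieval s e)) (rmem s))
        (icost i + icost e).+1
  | ExecRSet s a i e :
      exec (RSet a i e) s
        (State (imem s) (upd (rmem s) a (ieval s i) (reval s e)))
        (icost i + rcost e).+1
  | ExecSeq c1 c2 s s1 s2 k1 k2 :
      exec c1 s s1 k1 -> exec c2 s1 s2 k2 ->
      exec (Seq c1 c2) s s2 (k1 + k2)
  | ExecIf b c1 c2 s s' k :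
      exec (if beval s b then c1 else c2) s s' k ->
      exec (If b c1 c2) s s' (bcost b + k).+1
  | ExecWhileF b c s :
      ~~ beval s b -> exec (While b c) s s (bcost b).+1
  | ExecWhileT b c s s1 s2 k1 k2 :
      beval s b -> exec c s s1 k1 -> exec (While b c) s1 s2 k2 ->
      exec (While b c) s s2 (bcost b + k1 + k2).+1.

Lemma exec_det c s s1 s2 k1 k2 :
  exec c s s1 k1 -> exec c s s2 k2 -> s1 = s2 /\ k1 = k2.
Proof.
move=> H; elim: H s2 k2 => {c s s1 k1}
  [s|s a i e|s a i e|c1 c2 s t1 t2 j1 j2 _ IH1 _ IH2|b c1 c2 s t j _ IH
  |b c s nb|b c s t1 t2 j1 j2 hb _ IH1 _ IH2] s2 k2 H; inversion H; subst => //.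
- by case: (IH1 _ _ ltac:(eassumption)) => ? ?; subst;
    case: (IH2 _ _ ltac:(eassumption)) => ? ?; subst.
- by case: (IH _ _ ltac:(eassumption)) => ? ?; subst.
- by match goal with h : is_true (beval _ _) |- _ => rewrite h in nb end.
- by match goal with h : is_true (~~ _) |- _ => rewrite hb in h end.
- by case: (IH1 _ _ ltac:(eassumption)) => ? ?; subst;
    case: (IH2 _ _ ltac:(eassumption)) => ? ?; subst.
Qed.

(* The entry with mathematical index i of a vector indexed from off upwards   *)
(* (off = 1 for x and y, off = 2 for u); 0 if i is out of range.              *)
Definition entry (n off : nat) (v : 'rV[R]_n) (i : nat) : R :=
  if (off <= i)%N then oapp (v 0) 0 (insub (i - off)%N) else 0.

Section Family.

Variables (T L : nat) (C Vb V : R).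

(* C is the generation upper bound, Vb (overlined V) the start-up/shut-down   *)
(* ramp rate and V the ramp rate.                                             *)

Definition that (t : nat) : nat := maxn t.+1 L.+1.

Definition in_family (t m : nat) (S : {set 'I_T.+1}) : Prop :=
  [/\ (3 <= t <= T - 1)%N,
      (that t - t - 1 <= m <= T - t - 1)%N,
      m%:R <= (C - Vb) / V
    & forall i : 'I_T.+1, i \in S -> (that t + 1 <= i <= t + m)%N].

(* min {a in S u {t+m+1} : a > i}.  For m = that t - t - 1 and i = that t     *)
(* this set is empty; the value t+m+1 = i is then taken, so that d_i - i = 0  *)
(* and the d_i - i always add up to t+m+1 - that t.                           *)
Definition dnext (t m : nat) (S : {set 'I_T.+1}) (i : nat) : nat :=
  \big[minn/(t + m + 1)%N]_(a in S | (i < a)%N) (a : nat).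

Variables (x y : 'rV[R]_T) (u : 'rV[R]_(T.-1)).

Local Notation "x_[ i ]" := (entry 1 x i%N) (at level 0, i at level 99).
Local Notation "y_[ i ]" := (entry 1 y i%N) (at level 0, i at level 99).
Local Notation "u_[ i ]" := (entry 2 u i%N) (at level 0, i at level 99).

Definition phi (t : nat) : R :=
  V * \sum_(3 <= k < (minn (t - 2) (L - 1)).+1) (k - 2)%:R * u_[t - k].

Definition alpha (m : nat) : R := C - Vb - m%:R * V.

Definition lhs (t : nat) : R := x_[t - 2] - x_[t - 1] + x_[t].

Definition rhs (t m : nat) (S : {set 'I_T.+1}) : R :=
  Vb * y_[t - 2] - (Vb - V) * y_[t - 1] + Vb * y_[t]
  + V * (\sum_(t.+1 <= i < that t)
           (y_[i] - \sum_(0 <= j < (minn (L - 1) (i - 2)).+1) u_[i - j]))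
  + phi t
  + V * (\sum_(i < T.+1 | (i \in S) || (i == that t :> nat))
           ((dnext t m S i)%:R - i%:R) * (y_[i] - \sum_(0 <= j < L) u_[i - j]))
  + alpha m * (y_[t + m + 1] - \sum_(0 <= j < L) u_[t + m + 1 - j]).

Definition violation (t m : nat) (S : {set 'I_T.+1}) : R :=
  lhs t - rhs t m S.

Definition most_violated (t m : nat) (S : {set 'I_T.+1}) : Prop :=
  [/\ in_family t m S,
      0 < violation t m S
    & forall t' m' S', in_family t' m' S' ->
        violation t' m' S' <= violation t m S].

Definition none_violated : Prop :=
  forall t m S, in_family t m S -> violation t m S <= 0.

(* Input: integer array 0 holds T, L; real array 0 holds C, Vb, V; real       *)
(* arrays 1, 2, 3 hold x, y, u at their mathematical indices; all other cells *)
(* are 0.                                                                     *)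
Definition input : state :=
  State
    (fun a i => if a is 0 then nth 0%N [:: T; L] i else 0%N)
    (fun a i => match a with
                | 0 => nth 0 [:: C; Vb; V] i
                | 1 => x_[i]
                | 2 => y_[i]
                | 3 => u_[i]
                | _ => 0
                end).

(* Output: integer array 1 holds a flag (1 if some inequality is violated, 0  *)
(* otherwise), t and m; integer array 2 is the indicator of S on 0, ..., T.   *)
Definition separated (s : state) : Prop :=
  (imem s 1 0 = 0%N /\ none_violated) \/
  (imem s 1 0 = 1%N /\
   most_violated (imem s 1 1) (imem s 1 2)
     [set i : 'I_T.+1 | imem s 2 i != 0%N]).

End Family.

End Semantics.

(* Main.v *)
(* The number d_i - i counts the j with i <= j < d_i, so the sum over          *)
(* S u {that t} equals the sum, over that t <= j <= t + m, of                  *)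
(* w_i = y_i - sum_{j < L} u_{i-j} at the last point i <= j of S u {that t}.   *)
(* Each term is at least the running minimum of w from that t to j, and all    *)
(* these bounds are attained at once when S is the set of strict records of    *)
(* the running minimum.  Hence no search over S is needed: for fixed t one     *)
(* scan over m yields the violation of the best inequality for every (t, m),   *)
(* and S is rebuilt once for the winning pair.  This takes O(T^2) steps.       *)

Require Import Defs.
From HB Require Import structures.
From mathcomp Require Import all_boot all_order all_algebra.
From mathcomp Require Import reals.
From mathcomp Require Import zify ring.

Set Implicit Arguments.
Unset Strict Implicit.
Unset Printing Implicit Defensive.

Import Order.TTheory GRing.Theory Num.Theory.

Local Open Scope ring_scope.

(** Fix (t, m). By [violation_last], the violation for S is [best_violation t m], which does not
    depend on S, minus V times the total excess of the weights at the last points of S u {that t}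
    over the running minima. Since V > 0, this loss is nonnegative ([violation_le_best]), and it
    vanishes when S is the set of records ([violation_records]). The maximum over exponentially many
    S is therefore a closed formula in (t, m). When m grows by one, [minsum] gains one term, so each
    pair costs constant time once the weights are tabulated and the base value of t is computed by a
    loop of length L. With L < T, the tables, the search over pairs and the final reconstruction of
    S together cost a constant times T^2. [weights_correct], [search_correct] and [records_correct]
    prove these phases with a step-counting program logic whose main rule is [halts_for]. *)

Lemma ltn_bigmin (I : Type) (r : seq I) (P : pred I) (F : I -> nat) (n j : nat) :
  (j < \big[minn/n]_(i <- r | P i) F i)%N =
  (j < n)%N && all (fun i => P i ==> (j < F i)%N) r.
Proof.
elim: r => [|i r IH]; first by rewrite big_nil andbT.
rewrite big_cons /=; case: (P i) => //=.
by rewrite leq_min IH andbCA.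
Qed.

(** * Running minima and their strict records *)

Section RunningMinimum.

Variables (R : realType) (w : nat -> R).

(** Up to [h] the value is [w j] itself, with no minimum taken. With h = that t, the plain sum over
    S_0 and the minima from [that t] on thus form a single sum. *)
Fixpoint runmin (h j : nat) : R :=
  if j is j'.+1 then
    if (j <= h)%N then w j
    else if w j < runmin h j' then w j else runmin h j'
  else w 0.

Definition record (h i : nat) : bool :=
  (h < i)%N && (w i < runmin h i.-1).

Lemma runmin_id h j : (j <= h)%N -> runmin h j = w j.
Proof. by case: j => //= j ->. Qed.

Lemma runmin_le h i j : (h <= i <= j)%N -> runmin h j <= w i.
Proof.
elim: j => [|j IH] /andP[hi]; first by rewrite leqn0 => /eqP->.
rewrite leq_eqVlt => /predU1P[-> | ij] /=.
  by case: ifP => // _; case: ltP.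
have -> : (j.+1 <= h)%N = false by lia.
have {IH} := IH ltac:(lia).
by case: ltP => // /ltW; apply: le_trans.
Qed.

Lemma runmin_last_record h i j : (h <= i <= j)%N -> (i == h) || record h i ->
  (forall k, (i < k <= j)%N -> ~~ record h k) -> runmin h j = w i.
Proof.
elim: j => [|j IH] /andP[hi]; first by rewrite leqn0 => /eqP->.
rewrite leq_eqVlt => /predU1P[-> | ij] ri nr.
  case/orP: ri => [/eqP->|/andP[hj /= wj]]; first by rewrite runmin_id.
  by rewrite /= wj; case: ifP.
have := nr j.+1 ltac:(lia); rewrite /record /=.
have -> : (h < j.+1)%N by lia.
have -> /= : (j.+1 <= h)%N = false by lia.
move=> /negPf->; apply: IH => //; first by lia.
by move=> k kj; apply: nr; lia.
Qed.

End RunningMinimum.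

(** * Eliminating S: the best violation for each pair (t, m) *)

Section Reduction.

Variables (R : realType) (T L : nat) (C Vb V : R).
Variables (x y : 'rV[R]_T) (u : 'rV[R]_(T.-1)).

Local Notation "x_[ i ]" := (entry 1 x i%N) (at level 0, i at level 99).
Local Notation "y_[ i ]" := (entry 1 y i%N) (at level 0, i at level 99).
Local Notation "u_[ i ]" := (entry 2 u i%N) (at level 0, i at level 99).

Definition weight (i : nat) : R := y_[i] - \sum_(0 <= j < L) u_[i - j].

(* The cut-off of the sum in phi is dropped: the extra terms vanish, by the   *)
(* truncated k - 2 for k < 3 and by the zero entries of u below index 2.      *)
Definition base (t : nat) : R :=
  x_[t - 2] - x_[t - 1] + x_[t]
  - (Vb * y_[t - 2] - (Vb - V) * y_[t - 1] + Vb * y_[t])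
  - V * \sum_(0 <= k < L) (k - 2)%:R * u_[t - k].

Definition minsum (t m : nat) : R :=
  \sum_(t.+1 <= j < t + m + 1) runmin weight (that L t) j.

Definition best_violation (t m : nat) : R :=
  base t - V * minsum t m - alpha C Vb V m * weight (t + m + 1).

Lemma u_lt2 i : (i < 2)%N -> u_[i] = 0.
Proof. by rewrite /entry ltnNge => /negPf->. Qed.

Lemma phiE t : phi L V u t = V * \sum_(0 <= k < L) (k - 2)%:R * u_[t - k].
Proof.
rewrite /phi; congr (_ * _).
have e n : \sum_(3 <= k < n) (k - 2)%:R * u_[t - k] =
           \sum_(0 <= k < n) (k - 2)%:R * u_[t - k].
  case: (leqP n 3) => [n3|n3].
    rewrite big_geq // big_nat_cond big1 // => k /andP[/andP[_ kn] _].
    by rewrite (_ : (k - 2)%N = 0%N) ?mul0r //; lia.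
  rewrite [RHS](big_cat_nat (n := 3)) //=; last exact: ltnW.
  rewrite [X in X + _]big_nat_cond [X in X + _]big1 ?add0r //.
  move=> k /andP[/andP[_ kn] _].
  by rewrite (_ : (k - 2)%N = 0%N) ?mul0r //; lia.
rewrite e; case: (leqP L (minn (t - 2) (L - 1)).+1) => [Lm|Lm].
  case: L Lm => [|L'] Lm; last by congr (\sum_(_ <= _ < _) _); lia.
  by rewrite sub0n minn0 big_nat1 big_geq //= mul0r.
rewrite [RHS](big_cat_nat (n := (minn (t - 2) (L - 1)).+1)) //=; last exact: ltnW.
rewrite [X in _ + X]big_nat_cond [X in _ + X]big1 ?addr0 //.
move=> k /andP[/andP[k1 k2] _]; rewrite u_lt2 ?mulr0 //; lia.
Qed.

(** The terms beyond the cut-off read u below index 2, where [entry] is 0. So the points of S_0 have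
    the same weight formula as the later ones. *)
Lemma weight_cutoff i : (0 < L)%N -> (1 < i)%N ->
  y_[i] - \sum_(0 <= j < (minn (L - 1) (i - 2)).+1) u_[i - j] = weight i.
Proof.
move=> L0 i1; rewrite /weight; congr (_ - _).
rewrite [RHS](big_cat_nat (n := (minn (L - 1) (i - 2)).+1)) //=; last by lia.
rewrite [X in _ + X]big_nat_cond [X in _ + X]big1 ?addr0 //.
by move=> k /andP[/andP[k1 k2] _]; rewrite u_lt2 //; lia.
Qed.

Lemma dnext_bounds t m (S : {set 'I_T.+1}) i j :
  (j < dnext t m S i)%N =
  (j < t + m + 1)%N && [forall a : 'I_T.+1, (a \in S) && (i < a)%N ==> (j < a)%N].
Proof.
rewrite /dnext ltn_bigmin; congr (_ && _).
by apply/allP/forallP => [aP a|aP a _]; [exact/aP/mem_index_enum | exact: aP].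
Qed.

Lemma dnext_ge t m (S : {set 'I_T.+1}) i :
  (i <= t + m + 1)%N -> (i <= dnext t m S i <= t + m + 1)%N.
Proof.
move=> im; apply/andP; split.
  case: i im => // i im; rewrite dnext_bounds im /=.
  by apply/forallP => a; apply/implyP => /andP[_ /ltnW].
rewrite leqNgt dnext_bounds negb_and ltnn //.
Qed.

(** [p j] is the last point of S u {that t} not after j, described by the properties that the two
    bounds on the violation use. *)
Definition last_point t m (S : {set 'I_T.+1}) (p : nat -> nat) : Prop :=
  forall j, (that L t <= j < t + m + 1)%N ->
    [/\ (that L t <= p j <= j)%N,
        p j = that L t \/ exists2 i : 'I_T.+1, i \in S & p j = i
      & forall i : 'I_T.+1, i \in S -> ~~ (p j < i <= j)%N].

(** Double counting: the intervals [i, d_i) with i in S u {that t} partition the range from [that t]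
    to [t + m], and j lies in the interval that starts at its last point. *)
Lemma gap_sum t m (S : {set 'I_T.+1}) (w : nat -> R) :
  in_family L C Vb V t m S -> (L < T)%N ->
  exists p : nat -> nat,
    last_point t m S p /\
    \sum_(i < T.+1 | (i \in S) || (i == that L t :> nat))
       ((dnext t m S i)%:R - i%:R) * w i =
    \sum_(that L t <= j < t + m + 1) w (p j).
Proof.
move=> [tT mb _ SI] LT; set h := that L t.
have hm : (h <= t + m + 1)%N by rewrite /h; lia.
have hT : (h < T.+1)%N by rewrite /h; lia.
pose h' : 'I_T.+1 := Ordinal hT.
pose A := [set i | (i \in S) || (i == h :> nat)].
have Ah : h' \in A by rewrite inE eqxx orbT.
have Age (i : 'I_T.+1) : i \in A -> (h <= i <= t + m + 1)%N.
  rewrite inE => /orP[/SI|/eqP->]; last by rewrite leqnn.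
  by rewrite -/h; lia.
(* The cap [maxn j h] lets [h'] satisfy the predicate for every j, as the arg max requires; for j >=
   h it is just j. *)
pose q j : 'I_T.+1 := [arg max_(i > h' | (i \in A) && (i <= maxn j h)%N) (i : nat)].
have qP j : (h <= j < t + m + 1)%N ->
  [/\ q j \in A, (q j <= j)%N
    & forall i : 'I_T.+1, i \in A -> (i <= j)%N -> (i <= q j)%N].
  move=> hj; rewrite /q; case: arg_maxnP => [|i /andP[iA ij] imax].
    by rewrite Ah leq_maxr.
  have jh : maxn j h = j by lia.
  rewrite jh in ij; split => // k kA kj; apply: imax; rewrite kA jh //.
exists (fun j => nat_of_ord (q j)); split.
  move=> j hj; have [qA qj qmax] := qP j hj.
  split; first by have := Age _ qA; lia.
    by move: qA; rewrite inE => /orP[?|/eqP ?]; [right; exists (q j) | left].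
  move=> i iS; apply/negP => /andP[qi ij].
  by have := qmax i ltac:(by rewrite inE iS) ij; lia.
rewrite (eq_bigl (mem A)); last by move=> i; rewrite !inE.
transitivity (\sum_(i in A) \sum_(h <= j < t + m + 1 | (i <= j < dnext t m S i)%N) w i).
  apply: eq_bigr => i /Age hi.
  have /andP[id dm] := dnext_ge S (i := i) (t := t) (m := m) ltac:(lia).
  rewrite (eq_bigl (fun j => (i <= j)%N && (j < dnext t m S i)%N)) //.
  rewrite -(big_nat_widen _ _ _ _) //.
  rewrite -(big_nat_widenl _ _ _ predT); last by lia.
  by rewrite sumr_const_nat -natrB // mulr_natl.
rewrite (exchange_big_dep xpredT) //= big_nat_cond [RHS]big_nat_cond.
apply: eq_bigr => j /andP[hj _].
have [qA qj qmax] := qP j hj.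
rewrite (big_pred1 (q j)) // => i; rewrite /= dnext_bounds.
have -> /= : (j < t + m + 1)%N by lia.
(* A point i before [q j] would have d_i <= q j <= j, so only [q j] itself counts j. *)
apply/idP/eqP => [/and3P[iA ij /forallP jlt]|->].
  apply/val_inj/eqP => /=; rewrite eqn_leq qmax //= leqNgt; apply/negP => iq.
  have := jlt (q j); rewrite iq andbT ltnNge qj implybF => /negP; apply.
  move: qA; rewrite inE => /orP[// | /eqP qh].
  by have := Age _ iA; lia.
rewrite qA qj /=; apply/forallP => a; apply/implyP => /andP[aS qa].
rewrite ltnNge; apply/negP => aj.
by have := qmax a ltac:(by rewrite inE aS) aj; lia.
Qed.

Hypotheses (L_gt0 : (0 < L)%N) (L_ltT : (L < T)%N) (V_gt0 : 0 < V).

Lemma violation_last t m (S : {set 'I_T.+1}) :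
  in_family L C Vb V t m S ->
  exists p : nat -> nat,
    last_point t m S p /\
    violation L C Vb V x y u t m S = best_violation t m
      - V * \sum_(that L t <= j < t + m + 1)
              (weight (p j) - runmin weight (that L t) j).
Proof.
move=> fam; have [p [pP pS]] := gap_sum weight fam L_ltT.
exists p; split=> //; case: fam => tT mT _ _.
rewrite /violation /lhs /rhs /best_violation /base -phiE pS /minsum.
rewrite -/(weight (t + m + 1)).
rewrite (big_cat_nat (m := t.+1) (n := that L t) (F := runmin _ _)) /=;
  [|move: mT; rewrite /that; lia..].
have -> : \sum_(t.+1 <= i < that L t)
     (y_[i] - \sum_(0 <= j < (minn (L - 1) (i - 2)).+1) u_[i - j]) =
   \sum_(t.+1 <= i < that L t) runmin weight (that L t) i.
  rewrite big_nat_cond [RHS]big_nat_cond; apply: eq_bigr => i /andP[ti _].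
  by rewrite weight_cutoff ?runmin_id //; lia.
by rewrite [in RHS]sumrB; ring.
Qed.

Lemma violation_le_best t m (S : {set 'I_T.+1}) :
  in_family L C Vb V t m S ->
  violation L C Vb V x y u t m S <= best_violation t m.
Proof.
move=> /violation_last[p [pP ->]].
rewrite gerBl pmulr_rge0 // big_nat_cond sumr_ge0 // => j /andP[hj _].
by have [pj _ _] := pP _ hj; rewrite subr_ge0 runmin_le.
Qed.

Definition records t m : {set 'I_T.+1} :=
  [set i : 'I_T.+1 | record weight (that L t) i && (i <= t + m)%N].

(** The conditions on (t, m) as the program meets them: loop ranges, a test without truncated
    subtraction, and a bound on m with the denominator V cleared. *)
Definition admissible t m : bool :=
  [&& (3 <= t)%N, (t + m + 1 <= T)%N, (that L t <= t + m + 1)%N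
    & m%:R * V <= C - Vb].

Lemma admissible_in_family t m (S : {set 'I_T.+1}) :
  in_family L C Vb V t m S -> admissible t m.
Proof.
case=> tT mT mV _; rewrite /admissible -ler_pdivlMr // mV andbT.
by apply/and3P; split; lia.
Qed.

Lemma records_in_family t m :
  admissible t m -> in_family L C Vb V t m (records t m).
Proof.
case/and4P=> t3 mT hm mV; split; try lia; first by rewrite ler_pdivlMr.
by move=> i; rewrite inE /record => /andP[/andP[hi _] im]; lia.
Qed.

Lemma violation_records t m : admissible t m ->
  violation L C Vb V x y u t m (records t m) = best_violation t m.
Proof.
move=> adm; have [p [pP ->]] := violation_last (records_in_family adm).
have [_ mT _ _] := and4P adm.
rewrite big_nat_cond big1 ?mulr0 ?subr0 // => j /andP[hj _].
have [pj pS pmax] := pP _ hj; apply/eqP; rewrite subr_eq0; apply/eqP/esym.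
(* The last point is [that t] or a record, and no record follows it up to j, so the running minimum
   still has the value it took there. *)
apply: runmin_last_record => //.
  case: pS => [->|[i]]; first by rewrite eqxx.
  by rewrite inE => /andP[ri _] ->; rewrite ri orbT.
move=> k kj; apply/negP => rk.
have kT : (k < T.+1)%N by lia.
have /negP := pmax (Ordinal kT) ltac:(by rewrite inE rk /=; lia); exact.
Qed.

End Reduction.

(** * A program logic with step bounds *)

Section Hoare.

Variable R : realType.
Implicit Types (s : state R) (Q : state R -> Prop) (c : com).

Definition halts c k Q s : Prop :=
  exists s' k', [/\ exec c s s' k', (k' <= k)%N & Q s'].

Lemma halts_le c k k' Q s : (k' <= k)%N -> halts c k' Q s -> halts c k Q s.
Proof.
by move=> kk [s' [j [e jk q]]]; exists s', j; split=> //; apply: leq_trans kk.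
Qed.

Lemma halts_weaken c k Q Q' s :
  (forall s', Q s' -> Q' s') -> halts c k Q s -> halts c k Q' s.
Proof. by move=> QQ' [s' [j [e jk /QQ' q]]]; exists s', j. Qed.

Lemma halts_seq c1 c2 k1 k2 Q1 Q s :
  halts c1 k1 Q1 s -> (forall s', Q1 s' -> halts c2 k2 Q s') ->
  halts (Seq c1 c2) (k1 + k2) Q s.
Proof.
move=> [s1 [j1 [e1 le1 q1]]] /(_ _ q1)[s2 [j2 [e2 le2 q2]]].
by exists s2, (j1 + j2)%N; split=> //; [exact: ExecSeq e1 e2 | exact: leq_add].
Qed.

Lemma halts_if b c1 c2 k Q s :
  halts (if beval s b then c1 else c2) k Q s ->
  halts (If b c1 c2) (bcost b + k).+1 Q s.
Proof.
move=> [s' [j [e le q]]]; exists s', (bcost b + j).+1.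
by split=> //; [exact: ExecIf | rewrite ltnS leq_add2l].
Qed.

Fixpoint loop_free c : bool :=
  match c with
  | Skip | ISet _ _ _ | RSet _ _ _ => true
  | Seq c1 c2 | If _ c1 c2 => loop_free c1 && loop_free c2
  | While _ _ => false
  end.

(** The value at [While] is a dummy, excluded by [loop_free] in [halts_run]. *)
Fixpoint run c s : state R :=
  match c with
  | Skip | While _ _ => s
  | ISet a i e => State (upd (imem s) a (ieval s i) (ieval s e)) (rmem s)
  | RSet a i e => State (imem s) (upd (rmem s) a (ieval s i) (reval s e))
  | Seq c1 c2 => run c2 (run c1 s)
  | If b c1 c2 => if beval s b then run c1 s else run c2 s
  end.

Fixpoint run_cost c : nat :=
  match c with
  | Skip | While _ _ => 1
  | ISet _ i e => (icost i + icost e).+1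
  | RSet _ i e => (icost i + rcost e).+1
  | Seq c1 c2 => run_cost c1 + run_cost c2
  | If b c1 c2 => (bcost b + maxn (run_cost c1) (run_cost c2)).+1
  end.

Lemma halts_run c Q s :
  loop_free c -> Q (run c s) -> halts c (run_cost c) Q s.
Proof.
move=> lf q; suff [j [e le]] : exists j, exec c s (run c s) j /\ (j <= run_cost c)%N.
  by exists (run c s), j.
elim: c s lf {q} => [|a i e|a i e|c1 IH1 c2 IH2|b c1 IH1 c2 IH2|//] s /=.
- by exists 1%N; split=> //; exact: ExecSkip.
- by eexists; split; first exact: ExecISet.
- by eexists; split; first exact: ExecRSet.
- move=> /andP[/(IH1 s)[j1 [e1 l1]] /(IH2 (run c1 s))[j2 [e2 l2]]].
  by exists (j1 + j2)%N; split; [exact: ExecSeq e1 e2 | exact: leq_add].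
- move=> /andP[/(IH1 s)[j1 [e1 l1]] /(IH2 s)[j2 [e2 l2]]].
  exists (bcost b + if beval s b then j1 else j2).+1; split.
    by apply: ExecIf; case: ifP.
  by rewrite ltnS leq_add2l leq_max; case: ifP => _; rewrite ?l1 ?l2 ?orbT.
Qed.

Definition ivar a : iexp := IGet a (ILit 0).
Definition rvar a : rexp := RGet a (ILit 0).

Definition For a (lo hi : iexp) c : com :=
  Seq (ISet a (ILit 0) lo)
    (While (BIle (IAdd (ivar a) (ILit 1)) hi)
       (Seq c (ISet a (ILit 0) (IAdd (ivar a) (ILit 1))))).

(** The invariant must survive any change of the counter, and the body must restore it. Each round
    costs the body, the reading of [hi], and 12 steps for the guard, the loop and the increment; the
    extra round in [(n - l).+1] pays for the failing test. *)
Lemma halts_for (I : nat -> state R -> Prop) a lo hi c kc l n s :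
  ieval s lo = l -> (l <= n)%N -> I l s ->
  (forall i s v, I i s -> I i (State (upd (imem s) a 0 v) (rmem s))) ->
  (forall i s, I i s -> ieval s hi = n) ->
  (forall i s, (l <= i < n)%N -> I i s -> imem s a 0 = i ->
     halts c kc (fun s' => imem s' a 0 = i /\ I i.+1 s') s) ->
  halts (For a lo hi c) (icost lo + 2 + (n - l).+1 * (kc + icost hi + 12))
    (I n) s.
Proof.
move=> es ln Il Iupd Ihi Ibody.
apply: (@halts_seq _ _ _ _ (fun s' => imem s' a 0 = l /\ I l s')).
  have /= -> : (icost lo + 2)%N = run_cost (ISet a (ILit 0) lo) by rewrite /=; lia.
  apply: halts_run => //=; split; first by rewrite /upd !eqxx.
  exact: Iupd.
move=> {es Il}{}s [sl Il].
suff loop d i s' : d = (n - i)%N -> (i <= n)%N ->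
    [/\ (l <= i)%N, imem s' a 0 = i & I i s'] ->
    halts (While (BIle (IAdd (ivar a) (ILit 1)) hi)
             (Seq c (ISet a (ILit 0) (IAdd (ivar a) (ILit 1)))))
      ((n - i).+1 * (kc + icost hi + 12)) (I n) s'.
  exact: loop erefl ln _.
elim: d i s' {s sl Il} => [|d IH] i s dE ln' [li si Ii].
  have {}dE : i = n by lia.
  move: si Ii; rewrite dE => si Ii.
  exists s; eexists; split; last exact: Ii.
    by apply: ExecWhileF => /=; rewrite (Ihi _ _ Ii) si addn1 ltnn.
  by rewrite subnn /=; lia.
have [s1 [j1 [e1 le1 [s1i I1]]]] := Ibody i s ltac:(lia) Ii si.
pose s2 := State (upd (imem s1) a 0 i.+1) (rmem s1).
have I2 : [/\ (l <= i.+1)%N, imem s2 a 0 = i.+1 & I i.+1 s2].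
  by split; [exact: leqW | rewrite /= /upd !eqxx | exact: Iupd].
have [s3 [j3 [e3 le3 I3]]] := IH i.+1 s2 ltac:(lia) ltac:(lia) I2.
exists s3; eexists; split; last exact: I3.
  apply: ExecWhileT e3; first by rewrite /= (Ihi _ _ Ii) si addn1; lia.
  have /= := ExecISet s1 a (ILit 0) (IAdd (ivar a) (ILit 1)).
  by rewrite s1i addn1 => e2; apply: ExecSeq e1 e2.
have -> : (n - i = (n - i.+1).+1)%N by lia.
by rewrite mulSn /=; lia.
Qed.

End Hoare.

(** * The separation program *)

Definition T_e := IGet 0 (ILit 0).
Definition L_e := IGet 0 (ILit 1).
Definition C_e := RGet 0 (ILit 0).
Definition Vb_e := RGet 0 (ILit 1).
Definition V_e := RGet 0 (ILit 2).

(* Integer cells 3, 4, 5 hold the loop counters and that t; real array 4      *)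
(* holds the weights, real cells 5, 6, 7 the accumulated violation, the       *)
(* running minimum and the best violation found.                              *)
Definition weight_step : com :=
  RSet 4 (ivar 3) (RSub (RGet 4 (ivar 3)) (RGet 3 (ISub (ivar 3) (ivar 4)))).

Definition weight_init : com := RSet 4 (ivar 3) (RGet 2 (ivar 3)).

Definition weights_prog : com :=
  For 3 (ILit 0) (IAdd T_e (ILit 1))
    (Seq weight_init (For 4 (ILit 0) L_e weight_step)).

Definition base_init : com :=
  RSet 5 (ILit 0)
    (RSub
       (RAdd (RSub (RGet 1 (ISub (ivar 3) (ILit 2)))
                (RGet 1 (ISub (ivar 3) (ILit 1))))
          (RGet 1 (ivar 3)))
       (RAdd (RSub (RMul Vb_e (RGet 2 (ISub (ivar 3) (ILit 2))))
                (RMul (RSub Vb_e V_e) (RGet 2 (ISub (ivar 3) (ILit 1)))))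
          (RMul Vb_e (RGet 2 (ivar 3))))).

Definition base_step : com :=
  RSet 5 (ILit 0)
    (RSub (rvar 5)
       (RMul V_e (RMul (RNat (ISub (ivar 4) (ILit 2)))
                    (RGet 3 (ISub (ivar 3) (ivar 4)))))).

(* max{a,b} = a + [b - a]^+ *)
Definition that_e (t : iexp) : iexp :=
  IAdd (IAdd t (ILit 1))
    (ISub (IAdd L_e (ILit 1)) (IAdd t (ILit 1))).

Definition next_e : iexp := IAdd (IAdd (ivar 3) (ivar 4)) (ILit 1).

Definition candidate_e : rexp :=
  RSub (rvar 5)
    (RMul (RSub (RSub C_e Vb_e) (RMul (RNat (ivar 4)) V_e)) (RGet 4 next_e)).

Definition update_best : com :=
  If (BAnd (BIle (ivar 5) next_e)
        (BAnd (BRle (RMul (RNat (ivar 4)) V_e) (RSub C_e Vb_e))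
           (BNot (BRle candidate_e (rvar 7)))))
    (Seq (RSet 7 (ILit 0) candidate_e)
       (Seq (ISet 1 (ILit 0) (ILit 1))
          (Seq (ISet 1 (ILit 1) (ivar 3)) (ISet 1 (ILit 2) (ivar 4)))))
    Skip.

(** The command [c] runs exactly at strict records: it is empty during the search and marks an
    element of S during the reconstruction. *)
Definition update_min (j : iexp) (c : com) : com :=
  If (BIle j (ivar 5)) (RSet 6 (ILit 0) (RGet 4 j))
    (If (BNot (BRle (rvar 6) (RGet 4 j)))
       (Seq (RSet 6 (ILit 0) (RGet 4 j)) c) Skip).

(** The candidate is tested first because (t, m) uses minima only up to t + m; the minimum at t + m
    + 1 is then charged for m + 1. *)
Definition search_step : com :=
  Seq update_best
    (Seq (update_min next_e Skip)
       (RSet 5 (ILit 0) (RSub (rvar 5) (RMul V_e (rvar 6))))).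

(** The upper limit is max{3, T}, so the range stays well formed when T < 3. *)
Definition search_prog : com :=
  For 3 (ILit 3) (IAdd (ILit 3) (ISub T_e (ILit 3)))
    (Seq base_init
       (Seq (For 4 (ILit 0) L_e base_step)
          (Seq (ISet 5 (ILit 0) (that_e (ivar 3)))
             (For 4 (ILit 0) (ISub T_e (ivar 3)) search_step)))).

Definition records_step : com :=
  update_min (ivar 3) (ISet 2 (ivar 3) (ILit 1)).

Definition t_e := IGet 1 (ILit 1).
Definition m_e := IGet 1 (ILit 2).

Definition records_prog : com :=
  If (BIle (ILit 1) (ivar 1))
    (Seq (ISet 5 (ILit 0) (that_e t_e))
       (For 3 (IAdd t_e (ILit 1)) (IAdd (IAdd t_e m_e) (ILit 1)) records_step))
    Skip.

Definition separation_prog : com :=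
  Seq weights_prog (Seq search_prog records_prog).

(** * Correctness and running time of the program *)

Section Correctness.

Variables (R : realType) (T L : nat) (C Vb V : R).
Variables (x y : 'rV[R]_T) (u : 'rV[R]_(T.-1)).

Hypotheses (L_gt0 : (0 < L)%N) (L_ltT : (L < T)%N) (V_gt0 : 0 < V).

Local Notation w := (weight L y u).
Local Notation val := (best_violation L C Vb V x y u).
Local Notation adm := (admissible T L C Vb V).

Definition has_input (s : state R) : Prop :=
  [/\ imem s 0 0 = T, imem s 0 1 = L, rmem s 0 0 = C, rmem s 0 1 = Vb
    & rmem s 0 2 = V] /\
  [/\ forall i, rmem s 1 i = entry 1 x i, forall i, rmem s 2 i = entry 1 y i
    & forall i, rmem s 3 i = entry 2 u i].

Definition has_weights n (s : state R) : Prop :=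
  forall i, (i < n)%N -> rmem s 4 i = w i.

Definition empty_output (s : state R) : Prop :=
  [/\ imem s 1 0 = 0%N, rmem s 7 0 = 0 & forall i, imem s 2 i = 0%N].

Definition ready (s : state R) : Prop := has_input s /\ has_weights T.+1 s.

Lemma weights_correct s : has_input s -> empty_output s ->
  halts weights_prog (200 * T ^ 2) (fun s' => ready s' /\ empty_output s') s.
Proof.
move=> si so.
pose I n s := has_input s /\ empty_output s /\ has_weights n s.
apply: (@halts_weaken _ _ _ (I T.+1)) => [s' [i1 [i2 i3]]//|].
apply: halts_le; last first.
  apply: (@halts_for _ I _ _ _ _ _ 0 T.+1) => //.
  - by move=> i s' /= [[[-> _ _ _ _] _] _]; rewrite addn1.
  move=> i s' /andP[_ iT] [i1 [i2 i3]] si'.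
  apply: (@halts_seq _ _ _ _ _ (fun s' => imem s' 3 0 = i /\ I i s' /\
     rmem s' 4 i = entry 1 y i)).
    apply: halts_run => //=; rewrite si'; split=> //; split; last first.
      by rewrite /upd !eqxx /=; case: i1 => _ [_ -> _].
    split=> //; split=> // k ki; rewrite /= /upd /=.
    by rewrite ltn_eqF //; exact: i3.
  move=> s1 [s1i [I1 w1]].
  pose J j s := imem s 3 0 = i /\ I i s /\
     rmem s 4 i = entry 1 y i - \sum_(0 <= k < j) entry 2 u (i - k)%N.
  apply: (@halts_weaken _ _ _ (J L)).
    move=> s2 [e2 [[j1 [j2 j3]] w2]]; split=> //; split=> //; split=> // k.
    by rewrite ltnS leq_eqVlt => /predU1P[->|/j3].
  apply: (@halts_for _ J _ _ _ _ _ 0 L) => //.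
  - by split=> //; split=> //; rewrite big_geq // subr0.
  - by move=> j s2 /= [_ [[[[_ -> _ _ _] _] _] _]].
  move=> j s2 /andP[_ jL] [e2 [[j1 [j2 j3]] w2]] e2'.
  apply: halts_run => //=; rewrite e2 e2'; split=> //; split=> //; split.
    split=> //; split=> // k ki; rewrite /= /upd /=.
    by rewrite ltn_eqF //; exact: j3.
  rewrite /= /upd !eqxx /= w2; case: j1 => _ [_ _ ->].
  by rewrite big_nat_recr //= opprD addrA.
rewrite /= !subn0; have : (T * L <= T * T)%N by rewrite leq_mul2l ltnW ?orbT.
nia.
Qed.

(** The best value starts at 0 with flag 0, so a pair is stored only if its violation is positive.
    The cells for S stay empty until the search ends. *)
Definition incumbent (P : nat -> nat -> Prop) (s : state R) : Prop :=
  [/\ forall t m, adm t m -> P t m -> val t m <= rmem s 7 0,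
      forall i, imem s 2 i = 0%N
    & imem s 1 0 = 0%N /\ rmem s 7 0 = 0 \/
      imem s 1 0 = 1%N /\
      [/\ adm (imem s 1 1) (imem s 1 2), 0 < rmem s 7 0
        & rmem s 7 0 = val (imem s 1 1) (imem s 1 2)]].

Lemma incumbent_sub (P P' : nat -> nat -> Prop) s :
  (forall t m, adm t m -> P' t m -> P t m) -> incumbent P s -> incumbent P' s.
Proof. by move=> PP' [i1 i2 i3]; split=> // t m a /(PP' _ _ a); apply: i1. Qed.

Definition seen t m t' m' : Prop := (t' < t)%N \/ t' = t /\ (m' < m)%N.

(** At m = 0 no point has been scanned yet, so the cell of the running minimum is constrained only
    for m > 0. *)
Definition searching t m (s : state R) : Prop :=
  [/\ imem s 3 0 = t, imem s 5 0 = that L t, ready s,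
      rmem s 5 0 = base L Vb V x y u t - V * minsum L y u t m
    & (0 < m)%N -> rmem s 6 0 = runmin w (that L t) (t + m)].

Lemma update_best_correct t m s :
  (3 <= t)%N -> (t + m < T)%N ->
  searching t m s -> imem s 4 0 = m -> incumbent (seen t m) s ->
  halts update_best (run_cost update_best)
    (fun s' => imem s' 4 0 = m /\
       searching t m s' /\ incumbent (seen t m.+1) s') s.
Proof.
move=> t3 tmT st sm inc; apply: halts_run => //.
have [s3 s5 [[[_ _ eC eVb eV] _] ew] e5 _] := st.
rewrite /= s3 s5 sm eC eVb eV e5 ew; last by lia.
rewrite -/(alpha C Vb V m) -/(val t m).
have [i1 i2 i3] := inc.
have best_le : 0 <= rmem s 7 0 by case: i3 => [[_ ->]|[_ [_ /ltW]]].
have old r : rmem s 7 0 <= r -> (adm t m -> val t m <= r) ->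
    forall t' m', adm t' m' -> seen t m.+1 t' m' -> val t' m' <= r.
  move=> sr vr t' m' a [tt|[tt]].
    by apply: le_trans sr; apply: i1 => //; left.
  rewrite ltnS leq_eqVlt => /predU1P[mm|mm]; first by subst; exact: vr.
  by apply: le_trans sr; apply: i1 => //; right.
case: ifPn => [/and3P[hm mV]|nc].
  rewrite -ltNge => better; split=> //; split=> //.
  have a : adm t m by rewrite /admissible t3 addn1 tmT -addn1 hm.
  split=> [|//|]; first by apply: old => //=; exact: ltW.
  right; split=> //; rewrite /upd /= s3 sm; split=> //.
  exact: le_lt_trans better.
split=> //; split=> //; split=> //; apply: old => // /and4P[_ _ hm mV].
by move: nc; rewrite hm mV /= negbK.
Qed.

Lemma search_step_correct t m s :
  (3 <= t)%N -> (t + m < T)%N ->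
  searching t m s -> imem s 4 0 = m -> incumbent (seen t m) s ->
  halts search_step (run_cost search_step)
    (fun s' => imem s' 4 0 = m /\
       searching t m.+1 s' /\ incumbent (seen t m.+1) s') s.
Proof.
move=> t3 tmT st sm inc.
apply: halts_seq (update_best_correct t3 tmT st sm inc) _.
move=> {sm st inc}s1 [sm [st inc]].
have [s3 s5 [[[eT eL eC eVb eV] ein] ew] e5 e6] := st.
have wE : rmem s1 4 (t + m + 1)%N = w (t + m + 1) by apply: ew; lia.
apply: (@halts_seq _ _ _ _ _ (fun s' => imem s' 4 0 = m /\
    [/\ imem s' 3 0 = t, imem s' 5 0 = that L t, ready s',
      rmem s' 5 0 = base L Vb V x y u t - V * minsum L y u t m
    & rmem s' 6 0 = runmin w (that L t) (t + m + 1)]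
    /\ incumbent (seen t m.+1) s')).
  apply: halts_run => //=; rewrite s3 s5 sm wE.
  have rE : runmin w (that L t) (t + m + 1) =
      if (t + m + 1 <= that L t)%N then w (t + m + 1)
      else if w (t + m + 1) < runmin w (that L t) (t + m)
           then w (t + m + 1) else runmin w (that L t) (t + m) by rewrite addn1.
  case: ifP => [jh|jh]; first by rewrite rE jh.
  (* For m = 0 the new point t + 1 is at most [that t], so the stale minimum is overwritten and
     never read. *)
  have m0 : (0 < m)%N by move: jh; rewrite /that; lia.
  rewrite -ltNge e6 //.
  case: ifP => [wl|wl]; first by rewrite rE jh wl.
  by rewrite rE jh wl; split=> //; split=> //; split=> //; exact: e6.
move=> s2 [sm2 [[s23 s25 r2 s2acc s2min] inc2]].
have V2 : rmem s2 0 2 = V by case: r2 => [[[]]].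
apply: halts_run => //=; split=> //; split=> //; split=> //=.
  rewrite /upd /= s2acc s2min V2 /minsum.
  have -> : (t + m.+1 + 1 = (t + m + 1).+1)%N by lia.
  by rewrite [in RHS]big_nat_recr /=; [ring|lia].
by rewrite /upd /= s2min addn1 addnS.
Qed.

Lemma search_correct s : ready s -> empty_output s ->
  halts search_prog (2000 * T ^ 2)
    (fun s' => ready s' /\ incumbent (fun _ _ => True) s') s.
Proof.
move=> rs os.
pose I t s := ready s /\ incumbent (fun t' _ => t' < t)%N s.
apply: (@halts_weaken _ _ _ (I (maxn 3 T))).
  move=> s1 [r1 i1]; split=> //; apply: incumbent_sub i1 => t m.
  by case/and4P=> t3 tmT _ _ _; lia.
apply: halts_le; last first.
  apply: (@halts_for _ I _ _ _ _ _ 3 (maxn 3 T)) => //.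
  - by rewrite leq_maxl.
  - split=> //; case: os => o1 o2 o3; split=> //; last by left.
    by move=> t m /and4P[t3 _ _ _]; rewrite ltnNge t3.
  - by move=> t s1 /= [[[[-> _ _ _ _] _] _] _]; lia.
  move=> t s1 /andP[t3 tT] [r1 i1] s1t.
  have {}tT : (t < T)%N by lia.
  pose b0 := entry 1 x (t - 2) - entry 1 x (t - 1) + entry 1 x t -
    (Vb * entry 1 y (t - 2) - (Vb - V) * entry 1 y (t - 1) + Vb * entry 1 y t).
  pose J k s := imem s 3 0 = t /\ I t s /\
    rmem s 5 0 = b0 - V * \sum_(0 <= j < k) (j - 2)%:R * entry 2 u (t - j)%N.
  apply: (@halts_seq _ _ _ _ _ (J 0)).
    apply: halts_run => //=; split=> //; split=> //=; rewrite /upd /= s1t.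
    case: r1 => [[[_ _ _ -> ->] [ex ey _]] _].
    by rewrite !ex !ey big_geq // mulr0 subr0.
  move=> s2 J2; apply: (@halts_seq _ _ _ _ _ (J L)).
    apply: (@halts_for _ J _ _ _ _ _ 0 L) => //.
      by move=> k s3 /= [_ [[[[[_ -> _ _ _] _] _] _] _]].
    move=> k s3 _ [e3 [[r3 i3] a3]] k3; apply: halts_run => //=.
    split=> //; split=> //; split=> //=; rewrite /upd /= e3 k3 a3.
    case: r3 => [[[_ _ _ _ ->] [_ _ ->]] _].
    by rewrite [in RHS]big_nat_recr //=; ring.
  move=> {J2}s3 [t3' [[r3 i3] a3]].
  pose M m s := searching t m s /\ incumbent (seen t m) s.
  apply: (@halts_seq _ _ _ _ _ (M 0)).
    apply: halts_run => //; split; [split=> //=|].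
    - case: r3 => [[[_ e _ _ _] _] _].
      by rewrite /upd /= t3' e /that; lia.
    - have -> : minsum L y u t 0 = 0 by rewrite /minsum big_geq //; lia.
      by rewrite mulr0 subr0.
    by apply: incumbent_sub i3 => t' m _ [|[_]].
  move=> s4 M4.
  apply: (@halts_weaken _ _ _ (fun s => imem s 3 0 = t /\ M (T - t)%N s)).
    move=> s5 [-> [[_ _ r5 _ _] i5]]; split=> //; split=> //.
    (* An admissible pair with this t has m < T - t, so the inner loop has met all of them. *)
    apply: incumbent_sub i5 => t' m /and4P[_ tmT _ _].
    rewrite ltnS leq_eqVlt => /predU1P[e|]; last by left.
    by right; lia.
  apply: (@halts_weaken _ _ _ (M (T - t)%N)).
    by move=> s5 M5; split=> //; case: M5 => [[]].
  apply: halts_le; last first.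
    apply: (@halts_for _ M _ _ _ _ _ 0 (T - t)%N) => //.
      by move=> m s5 /= [[-> _ [[[-> _ _ _ _] _] _] _ _] _].
    move=> m s5 /andP[_ mT] [st inc] em.
    by apply: search_step_correct => //; lia.
  have h : ((T - t - 0).+1 <= T)%N by lia.
  exact: leq_add (leqnn _) (leq_mul h (leqnn _)).
rewrite /= !subn0; have : (T * L <= T * T)%N by rewrite leq_mul2l ltnW ?orbT.
have : ((maxn 3 T - 3).+1 <= T)%N by lia.
move: (maxn 3 T - 3).+1 => N NT LT.
have : (N * L <= T * L)%N by rewrite leq_mul2r NT orbT.
have : (N * T <= T * T)%N by rewrite leq_mul2r NT orbT.
nia.
Qed.

Lemma records_correct s : ready s -> incumbent (fun _ _ => True) s ->
  halts records_prog (200 * T) (separated L C Vb V x y u) s.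
Proof.
move=> rs [best empty out].
case: out => [[flag0 best0]|[flag1 [a best_gt0 bestE]]].
  apply: halts_le; last first.
    apply: halts_if; rewrite /= flag0 /=; apply: halts_run => //=.
    (* Flag 0 means that the best value is still 0, and it bounds every [best_violation], hence
       every violation. *)
    left; split=> // t m S fam.
    apply: le_trans (violation_le_best _ _ _ _ _ _ fam) _ => //.
    by rewrite -best0; apply: best => //; exact: admissible_in_family fam.
  by rewrite /=; lia.
set t := imem s 1 1 in a bestE; set m := imem s 1 2 in a bestE.
have [t3 tmT hm _] := and4P a.
pose h := that L t.
have th : (t < h)%N by rewrite /h /that; lia.
pose I i s' := [/\ imem s' 1 0 = 1%N, imem s' 1 1 = t, imem s' 1 2 = m,
    imem s' 5 0 = h & has_weights T.+1 s'] /\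
  ((t.+1 < i)%N -> rmem s' 6 0 = runmin w h i.-1) /\
  forall k, (imem s' 2 k != 0%N) = (record w h k && (k < i)%N).
apply: halts_le; last first.
  apply: halts_if; rewrite /= flag1 /=.
  apply: (@halts_seq _ _ _ _ _ (I t.+1)).
    apply: halts_run => //; split; last split; first split=> //=.
    - by case: rs => [[[_ eL _ _ _] _] _]; rewrite /upd /= eL /h /that; lia.
    - by case: rs.
    - by rewrite ltnn.
    (* Records lie beyond [that t] > t, so the empty indicator is right at the start. *)
    move=> k; rewrite /= /upd /= empty eqxx /record; case: leqP => //= hk.
    by rewrite ltnNge (ltn_trans th hk) andbF.
  move=> s1 I1; apply: (@halts_weaken _ _ _ (I (t + m + 1)%N)).
    move=> s2 [[f2 t2 m2 _ _] [_ S2]]; right; split=> //; rewrite t2 m2.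
    have -> : [set i : 'I_T.+1 | imem s2 2 i != 0%N] = records L y u t m.
      by apply/setP => i; rewrite !inE S2 addn1 ltnS.
    split; first exact: records_in_family.
      by rewrite violation_records // -bestE.
    move=> t' m' S' fam; rewrite violation_records //.
    apply: le_trans (violation_le_best _ _ _ _ _ _ fam) _ => //.
    by rewrite -bestE; apply: best => //; exact: admissible_in_family fam.
  apply: halts_le; last first.
    apply: (@halts_for _ I _ _ _ _ _ t.+1 (t + m + 1)%N) => //=.
    - by case: I1 => [[_ -> _ _ _] _]; rewrite addn1.
    - by lia.
    - by move=> i s2 [[_ -> -> _ _] _].
    move=> i s2 /andP[ti im] [[f2 t2 m2 h2 w2] [c2 S2]] e2.
    have wi : rmem s2 4 i = w i by apply: w2; lia.
    have recE : record w h i = (h < i)%N && (w i < runmin w h i.-1) by [].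
    (* Here b tells whether i is a record; the three branches below use this with b false, true and
       false. *)
    have SE (b : bool) (f : nat -> nat) :
        (forall k, f k = if (k == i) && b then 1%N else imem s2 2 k) ->
        record w h i = b ->
        forall k, (f k != 0%N) = record w h k && (k < i.+1)%N.
      move=> fE rb k; rewrite fE ltnS leq_eqVlt.
      case: (eqVneq k i) => [->|ki] /=; last exact: S2.
      by rewrite rb; case: b {fE} rb => //= rb; rewrite S2 rb.
    apply: halts_run => //=; rewrite e2 h2 wi.
    have minE : runmin w h i = if (i <= h)%N then w i
       else if w i < runmin w h i.-1 then w i else runmin w h i.-1.
      by case: (i) ti.
    case: ifP => [ih|ih].
      split=> //; split=> //; split=> [_|] /=; first by rewrite minE ih.
      apply: (SE false) => [k|]; first by rewrite andbF.
      by rewrite recE ltnNge ih.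
    have hi : (h < i)%N by rewrite ltnNge ih.
    rewrite -ltNge c2; last by lia.
    case: ifP => [wl|wl].
      split=> //; split=> //; split=> [_|] /=; first by rewrite minE ih wl.
      apply: (SE true) => [k|]; last by rewrite recE hi wl.
      by rewrite /upd /= andbT.
    split=> //; split=> //; split=> [_|].
      by rewrite minE ih wl c2 //; lia.
    apply: (SE false) => [k|]; first by rewrite andbF.
    by rewrite recE hi wl.
  have ln : ((t + m + 1 - t.+1).+1 <= T)%N by lia.
  exact: leq_add (leqnn _) (leq_mul ln (leqnn _)).
by rewrite /=; lia.
Qed.

Lemma separation_correct :
  halts separation_prog (2400 * T ^ 2) (separated L C Vb V x y u)
    (input L C Vb V x y u).
Proof.
apply: halts_le; last first.
  apply: halts_seq (weights_correct _ _) _ => //.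
  move=> s1 [r1 o1]; apply: halts_seq (search_correct r1 o1) _.
  by move=> s2 [r2 i2]; exact: records_correct.
by nia.
Qed.

End Correctness.

Theorem proposition17 (R : realType) :
  exists prog : com,
    forall rho : R, exists K : nat,
      forall (T L : nat) (C Vb V : R)
             (x y : 'rV[R]_T) (u : 'rV[R]_(T.-1)),
        (0 < L)%N -> (L + 1 <= T)%N ->
        Vb <= C -> 0 < V -> (C - Vb) / V = rho ->
        (forall i, 0 <= x 0 i) -> (forall i, 0 <= y 0 i) ->
        (forall i, 0 <= u 0 i) ->
        exists (s : state R) (k : nat),
          [/\ exec prog (input L C Vb V x y u) s k,
              (k <= K * T ^ 3)%N
            & separated L C Vb V x y u s].
Proof.
(* The constant is the sum 200 + 2000 + 200 over the three phases, and T^2 <= T^3. *)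
exists separation_prog => rho; exists 2400%N.
move=> T L C Vb V x y u L0 LT _ V0 _ _ _ _.
rewrite addn1 in LT.
have [s [k [e le sep]]] := separation_correct C Vb x y u L0 LT V0.
exists s, k; split=> //; apply: leq_trans le _.
by rewrite leq_mul2l leq_pexp2l ?orbT //; lia.
Qed.
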